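(* Let $\mathbb{GA}_N$ be an $N$-dimensional manifold with a non-symmetric affine connection with coefficients $L^i_{jk}$. For all $p,q,r,s\in\{1,2,3\}$ there are coefficients $c_1,\ldots,c_{17}\in\{0,1,-1\}$ (depending only on $p,q,r,s$) such that every tensor $a^i_j$ of type $(1,1)$ satisfies the Ricci-type identity $$\begin{aligned} a^i_{j\underset{p}{|}m\underset{q}{|}n}-a^i_{j\underset{r}{|}n\underset{s}{|}m}={}&2c_1L^\alpha_{\underset{\vee}{jm}}a^i_{\alpha|n}+2c_2L^\alpha_{\underset{\vee}{jn}}a^i_{\alpha|m}+2c_3L^\alpha_{\underset{\vee}{mn}}a^i_{j|\alpha}+2c_4L^i_{\underset{\vee}{\alpha n}}a^\alpha_{j|m}+2c_5L^i_{\underset{\vee}{\alpha m}}a^\alpha_{j|n}\\ &+a^\alpha_j\big(R^i_{\alpha mn}+c_6L^i_{\underset{\vee}{\alpha m}|n}+c_7L^i_{\underset{\vee}{\alpha n}|m}+c_8L^\beta_{\underset{\vee}{\alpha m}}L^i_{\underset{\vee}{\beta n}}+c_9L^\beta_{\underset{\vee}{\alpha n}}L^i_{\underset{\vee}{\beta m}}+2c_{10}L^i_{\underset{\vee}{\alpha\beta}}L^\beta_{\underset{\vee}{mn}}\big)\\ &-a^i_\alpha\big(R^\alpha_{jmn}+c_{11}L^\alpha_{\underset{\vee}{jm}|n}+c_{12}L^\alpha_{\underset{\vee}{jn}|m}+c_{13}L^\alpha_{\underset{\vee}{\beta n}}L^\beta_{\underset{\vee}{jm}}+c_{14}L^\alpha_{\underset{\vee}{\beta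 m}}L^\beta_{\underset{\vee}{jn}}+2c_{15}L^\alpha_{\underset{\vee}{j\beta}}L^\beta_{\underset{\vee}{mn}}\big)\\ &-2a^\alpha_\beta\big(c_{16}L^i_{\underset{\vee}{\alpha m}}L^\beta_{\underset{\vee}{jn}}+c_{17}L^i_{\underset{\vee}{\alpha n}}L^\beta_{\underset{\vee}{jm}}\big). \end{aligned}$$
   Context: The coefficients $L^i_{jk}$ are in general not symmetric in $j,k$. Put $L^i_{\underline{jk}}=\frac12(L^i_{jk}+L^i_{kj})$ and $L^i_{\underset{\vee}{jk}}=\frac12(L^i_{jk}-L^i_{kj})$ (the latter is a tensor, half of the torsion). A comma denotes a partial derivative and repeated Greek indices are summed. The sign $|$ without a number denotes covariant differentiation with respect to the symmetric connection with coefficients $L^i_{\underline{jk}}$, e.g. $a^i_{j|k}=a^i_{j,k}+L^i_{\underline{\alpha k}}a^\alpha_j-L^\alpha_{\underline{jk}}a^i_\alpha$, and $$R^i_{jmn}=L^i_{\underline{jm},n}-L^i_{\underline{jn},m}+L^\alpha_{\underline{jm}}L^i_{\underline{\alpha n}}-L^\alpha_{\underline{jn}}L^i_{\underline{\alpha m}}$$ is its curvature tensor. The covariant derivatives of kinds $1,2,3$ are $$a^i_{j\underset{1}{|}k}=a^i_{j,k}+L^i_{\alpha k}a^\alpha_j-L^\alpha_{jk}a^i_\alpha,\quad a^i_{j\underset{2}{|}k}=a^i_{j,k}+L^i_{k\alpha}a^\alpha_j-L^\alpha_{kj}a^i_\alpha,\quad a^i_{j\underset{3}{|}k}=a^i_{j,k}+L^i_{\alpha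 k}a^\alpha_j-L^\alpha_{kj}a^i_\alpha,$$ and they extend to tensors with more indices by the same rule applied to each index; for a $(1,2)$ tensor $b^i_{jm}$: $$b^i_{jm\underset{1}{|}n}=b^i_{jm,n}+L^i_{\alpha n}b^\alpha_{jm}-L^\alpha_{jn}b^i_{\alpha m}-L^\alpha_{mn}b^i_{j\alpha},$$ $$b^i_{jm\underset{2}{|}n}=b^i_{jm,n}+L^i_{n\alpha}b^\alpha_{jm}-L^\alpha_{nj}b^i_{\alpha m}-L^\alpha_{nm}b^i_{j\alpha},$$ $$b^i_{jm\underset{3}{|}n}=b^i_{jm,n}+L^i_{\alpha n}b^\alpha_{jm}-L^\alpha_{nj}b^i_{\alpha m}-L^\alpha_{nm}b^i_{j\alpha}.$$ Then $a^i_{j\underset{p}{|}m\underset{q}{|}n}$ is the derivative of kind $q$ in direction $n$ of $b^i_{jm}=a^i_{j\underset{p}{|}m}$, and $a^i_{j\underset{r}{|}n\underset{s}{|}m}$ is the derivative of kind $s$ in direction $m$ of $b^i_{jn}=a^i_{j\underset{r}{|}n}$. *)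

(* Defs.v *)
From HB Require Import structures.
From mathcomp Require Import all_boot all_order all_algebra.
From mathcomp Require Import all_classical all_reals all_analysis.

Set Implicit Arguments.
Unset Strict Implicit.
Unset Printing Implicit Defensive.

Import Order.TTheory GRing.Theory Num.Theory.
Import numFieldNormedType.Exports.

Local Open Scope classical_set_scope.
Local Open Scope ring_scope.

Section Smooth.
Variables (R : realType) (N : nat).

Definition partial (k : 'I_N) (f : 'rV[R]_N -> R) (x : 'rV[R]_N) : R :=
  'D_(delta_mx 0 k) f x.

(* Meant for open [U]: the values of [f] outside [U] are then irrelevant. *)
Fixpoint Cn_on (n : nat) (U : set 'rV[R]_N) (f : 'rV[R]_N -> R) : Prop :=
  match n with
  | 0 => forall x, U x -> {for x, continuous f}
  | n'.+1 => [/\ forall x, U x -> {for x, continuous f},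
                forall k x, U x -> derivable f x (delta_mx 0 k) &
                forall k, Cn_on n' U (partial k f)]
  end.

Definition smooth_on (U : set 'rV[R]_N) (f : 'rV[R]_N -> R) : Prop :=
  forall n, Cn_on n U f.

End Smooth.

(* A smooth N-manifold with an atlas indexed by [chart].  The functions
   [coord u] and [param u] are total, but meaningful only on [dom u] and
   [img u]: they restrict to mutually inverse homeomorphisms between the open
   sets [dom u] and [img u].  [coord v (param u x)] is the change of
   coordinates from [u] to [v], defined on the [x] in [img u] with
   [dom v (param u x)]. *)
Record manifold (R : realType) (N : nat) := Manifold {
  carrier :> topologicalType;
  carrier_hausdorff : hausdorff_space carrier;
  carrier_second_countable : @second_countable carrier;
  chart : Type;
  dom : chart -> set carrier;
  img : chart -> set 'rV[R]_N;
  coord : chart -> carrier -> 'rV[R]_N;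
  param : chart -> 'rV[R]_N -> carrier;
  dom_open : forall u, open (dom u);
  img_open : forall u, open (img u);
  dom_cover : forall P, exists u, dom u P;
  coord_img : forall u P, dom u P -> img u (coord u P);
  param_dom : forall u x, img u x -> dom u (param u x);
  coordK : forall u P, dom u P -> param u (coord u P) = P;
  paramK : forall u x, img u x -> coord u (param u x) = x;
  coord_continuous : forall u P, dom u P -> {for P, continuous (coord u)};
  param_continuous : forall u x, img u x -> {for x, continuous (param u)};
  change_smooth : forall u v k,
    smooth_on [set x | img u x /\ dom v (param u x)]
              (fun x => coord v (param u x) 0 k)
}.

Section Manifold.
Variables (R : realType) (N : nat) (M : manifold R N).

Definition overlap (u v : chart M) : set 'rV[R]_N :=
  [set x | img u x /\ dom v (param u x)].

Definition change (u v : chart M) (k : 'I_N) (x : 'rV[R]_N) : R :=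
  coord v (param u x) 0 k.

(* [conn_coef u i j k] is L^i_{jk} as a function of the coordinates of the
   chart [u]. No symmetry in [j], [k] is assumed. *)
Record connection := Connection {
  conn_coef :> chart M -> 'I_N -> 'I_N -> 'I_N -> 'rV[R]_N -> R;
  conn_smooth : forall u i j k, smooth_on (img u) (conn_coef u i j k);
  conn_change : forall u v x, overlap u v x ->
    forall i j k, let y := coord v (param u x) in
    conn_coef v i j k y =
      \sum_(l < N) partial l (change u v i) x *
        (partial k (partial j (change v u l)) y +
         \sum_(b < N) \sum_(c < N)
            conn_coef u l b c x * partial j (change v u b) y
                                * partial k (change v u c) y)
}.

(* [tens_comp u i j] is a^i_j in the chart [u]. *)
Record tensor11 := Tensor11 {
  tens_comp :> chart M -> 'I_N -> 'I_N -> 'rV[R]_N -> R;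
  tens_smooth : forall u i j, smooth_on (img u) (tens_comp u i j);
  tens_change : forall u v x, overlap u v x ->
    forall i j, let y := coord v (param u x) in
    tens_comp v i j y =
      \sum_(l < N) \sum_(b < N)
        partial l (change u v i) x * partial j (change v u b) y *
        tens_comp u l b x
}.

End Manifold.

Variant kind := K1 | K2 | K3.

(* Component calculus in one chart.  The upper index comes first, followed by
   the lower indices in the order in which they are written, and the direction
   of differentiation last: [cov12 p L b i j m n x] is b^i_{jm |_p n}. *)
Section Components.
Variables (R : realType) (N : nat).

Notation comp11 := ('I_N -> 'I_N -> 'rV[R]_N -> R).
Notation comp12 := ('I_N -> 'I_N -> 'I_N -> 'rV[R]_N -> R).

Definition symm_part (L : comp12) : comp12 :=
  fun i j k x => 2^-1 * (L i j k x + L i k j x).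

Definition skew_part (L : comp12) : comp12 :=
  fun i j k x => 2^-1 * (L i j k x - L i k j x).

(* The coefficient which contracts an upper index, resp. a lower index, in the
   derivative of kind [p] in direction [k]. *)
Definition up_coef (p : kind) (L : comp12) (i al k : 'I_N) (x : 'rV[R]_N) : R :=
  match p with K1 | K3 => L i al k x | K2 => L i k al x end.

Definition low_coef (p : kind) (L : comp12) (al j k : 'I_N) (x : 'rV[R]_N) :
    R :=
  match p with K1 => L al j k x | K2 | K3 => L al k j x end.

Definition cov11 (p : kind) (L : comp12) (a : comp11) : comp12 :=
  fun i j k x =>
    partial k (a i j) x
    + \sum_(al < N) up_coef p L i al k x * a al j x
    - \sum_(al < N) low_coef p L al j k x * a i al x.

Definition cov12 (p : kind) (L : comp12) (b : comp12) (i j m n : 'I_N)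
    (x : 'rV[R]_N) : R :=
  partial n (b i j m) x
  + \sum_(al < N) up_coef p L i al n x * b al j m x
  - \sum_(al < N) low_coef p L al j n x * b i al m x
  - \sum_(al < N) low_coef p L al m n x * b i j al x.

(* Differentiation with respect to the symmetric part of [L], for which the
   three kinds coincide. *)
Definition scov11 (L : comp12) := cov11 K1 (symm_part L).
Definition scov12 (L : comp12) := cov12 K1 (symm_part L).

Definition curvature (L : comp12) (i j m n : 'I_N) (x : 'rV[R]_N) : R :=
  let S := symm_part L in
  partial n (S i j m) x - partial m (S i j n) x
  + \sum_(al < N) S al j m x * S i al n x
  - \sum_(al < N) S al j n x * S i al m x.

End Components.

(* Main.v *)
(* Write L = S + T with S symmetric and T skew in the lower indices.  The
   derivative of kind p is the derivative with respect to S plus terms linear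
   in T, whose signs e_p (upper index) and f_p (lower index) depend on p.
   Expanding twice, the second partial derivatives of a cancel by Schwarz's
   theorem, the terms free of T give the curvature of S, and the others are
   sorted into the seventeen tensors: each coefficient is a sign, a product of
   two signs, or half a sum or difference of two of these.  At a fixed point,
   every term is a product of the matrices a, S_k, T_k and of their
   derivatives, so that the identity is one in the noncommutative ring of
   matrices. *)

Require Import Defs.
From HB Require Import structures.
From mathcomp Require Import all_boot all_order all_algebra.
From mathcomp Require Import all_classical all_reals all_analysis.
From mathcomp Require Import ring.

Set Implicit Arguments.
Unset Strict Implicit.
Unset Printing Implicit Defensive.

Import Order.TTheory GRing.Theory Num.Theory.
Import numFieldNormedType.Exports.

Local Open Scope ring_scope.

(** * Symmetry of mixed directional derivatives *)

Section MixedDerivatives.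
Variables (R : realType) (V : normedModType R).
Implicit Types (f : V -> R) (v w x y : V).

(** Restriction to a line makes the one-variable [MVT] applicable; both difference quotients are the
    same function of [h]. *)
Lemma is_derive_along f v y (s : R) : derivable f (s *: v + y) v ->
  is_derive s 1 (fun t => f (t *: v + y)) ('D_v f (s *: v + y)).
Proof.
have E : (fun h : R => h^-1 *: (((fun t => f (t *: v + y)) \o shift s) (h *: 1)
            - f (s *: v + y))) =
         (fun h => h^-1 *: ((f \o shift (s *: v + y)) (h *: v)
            - f (s *: v + y))).
  by apply/funext => h /=; rewrite [h *: 1]mulr1 scalerDl addrA.
by move=> df; apply: DeriveDef; rewrite /derivable /derive E.
Qed.

(** The mean value theorem is applied twice: in direction [v] to the increment of [f] along
    [t *: w], then in direction [w] to ['D_v f]. *)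
Lemma second_difference f v w x (t : R) : 0 < t ->
  (forall s s', 0 <= s <= t -> 0 <= s' <= t ->
    let y := s *: v + (s' *: w + x) in
    derivable f y v /\ derivable ('D_v f) y w) ->
  exists s s', [/\ 0 <= s <= t, 0 <= s' <= t &
    f (t *: v + (t *: w + x)) - f (t *: v + x) - f (t *: w + x) + f x =
    'D_w ('D_v f) (s *: v + (s' *: w + x)) * t ^+ 2].
Proof.
move=> t0 H.
have tt : 0 <= t <= t by rewrite ltW //=.
have oo : 0 <= (0 : R) <= t by rewrite lexx ltW.
pose g s := f (s *: v + (t *: w + x)) - f (s *: v + x).
pose g' s := 'D_v f (s *: v + (t *: w + x)) - 'D_v f (s *: v + x).
have dg s : 0 <= s <= t -> is_derive s 1 g (g' s).
  move=> s0t; apply: is_deriveB; apply: is_derive_along.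
    by have [] := H _ _ s0t tt.
  by have [] := H _ _ s0t oo; rewrite scale0r add0r.
have [||s s0t Eg] := MVT (f := g) (df := g') t0.
- by move=> s s0t; apply: dg; rewrite !ltW ?(itvP s0t).
- apply: derivable_within_continuous => s s0t.
  by apply: ex_derive; apply: dg; rewrite !(itvP s0t).
have {}s0t : 0 <= s <= t by rewrite !ltW ?(itvP s0t).
pose k s' := 'D_v f (s' *: w + (s *: v + x)).
pose k' s' := 'D_w ('D_v f) (s' *: w + (s *: v + x)).
have dk s' : 0 <= s' <= t -> is_derive s' 1 k (k' s').
  move=> s'0t; apply: is_derive_along.
  by rewrite addrCA; have [] := H _ _ s0t s'0t.
have [||s' s'0t Ek] := MVT (f := k) (df := k') t0.
- by move=> s' s'0t; apply: dk; rewrite !ltW ?(itvP s'0t).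
- apply: derivable_within_continuous => s' s'0t.
  by apply: ex_derive; apply: dk; rewrite !(itvP s'0t).
have {}s'0t : 0 <= s' <= t by rewrite !ltW ?(itvP s'0t).
exists s, s'; split=> //.
move: Eg Ek; rewrite /g /g' /k /k' !scale0r !add0r !subr0.
rewrite ![_ *: w + (s *: v + x)]addrCA.
move=> Eg Ek; rewrite expr2 mulrA -Ek -Eg; ring.
Qed.

(* The same second difference of f, divided by t^2, is a value near x of either
   mixed derivative. *)
Lemma derive_comm f v w x :
  (\forall y \near x, derivable f y v /\ derivable ('D_v f) y w) ->
  (\forall y \near x, derivable f y w /\ derivable ('D_w f) y v) ->
  {for x, continuous ('D_w ('D_v f))} -> {for x, continuous ('D_v ('D_w f))} ->
  'D_w ('D_v f) x = 'D_v ('D_w f) x.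
Proof.
move=> Hv Hw Cv Cw; apply/eqP; rewrite -subr_eq0 -normr_le0.
apply/ler_addgt0Pl => /= e e0; rewrite addr0.
have e2 : 0 < e / 2 by rewrite divr_gt0.
have /cvgrPdist_lt /(_ _ e2) Nv := Cv; have /cvgrPdist_lt /(_ _ e2) Nw := Cw.
have [d /= d0 B] :=
  (nbhs_ballP x _).1 (filterI (filterI Hv Hw) (filterI Nv Nw)).
(* This [t] puts the whole parallelogram spanned by [t *: v] and [t *: w] at [x] inside the ball;
   the summand 1 keeps the denominator positive and the estimate strict. *)
pose t := d / (`|v| + `|w| + 1).
have c0 : 0 < `|v| + `|w| + 1 by rewrite ltr_wpDl ?addr_ge0.
have t0 : 0 < t by rewrite divr_gt0.
have near_x s s' : 0 <= s <= t -> 0 <= s' <= t ->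
    ball x d (s *: v + (s' *: w + x)).
  move=> /andP[s0 st] /andP[s'0 s't].
  rewrite -ball_normE /= addrA opprD addrCA subrr addr0 normrN.
  apply: le_lt_trans (ler_normD _ _) _; rewrite !normrZ !ger0_norm //.
  have -> : d = t * (`|v| + `|w| + 1) by rewrite /t divfK ?gt_eqF.
  rewrite !mulrDr mulr1; apply: (@le_lt_trans _ _ (t * `|v| + t * `|w|)).
    by rewrite lerD // ler_wpM2r.
  by rewrite ltrDl.
have [|s [s' [s0t s'0t Es]]] := @second_difference f v w x t t0.
  move=> s s' s0t s'0t.
  by have [[Bs _] _] := B _ (near_x _ _ s0t s'0t); exact: Bs.
have [|r [r' [r0t r'0t Er]]] := @second_difference f w v x t t0.
  move=> r r' r0t r'0t; rewrite addrCA.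
  by have [[_ Br] _] := B _ (near_x _ _ r'0t r0t); exact: Br.
(* The second difference is symmetric in [v] and [w], so both mixed derivatives take a common value
   near [x], within [e / 2] of each value at [x]. *)
have E : 'D_w ('D_v f) (s *: v + (s' *: w + x)) =
         'D_v ('D_w f) (r *: w + (r' *: v + x)).
  apply: (@mulIf _ (t ^+ 2)); first by rewrite expf_neq0 ?gt_eqF.
  by rewrite -Es -Er [t *: w + (t *: v + x)]addrCA; ring.
have [_ [Bv _]] := B _ (near_x _ _ s0t s'0t).
have [_ [_ Bw]] := B _ (near_x _ _ r'0t r0t).
rewrite addrCA -E distrC in Bw.
apply: ltW; apply: le_lt_trans (ler_distD _ _ _) _.
by rewrite [e]splitr; apply: ltrD; [exact: Bv | exact: Bw].
Qed.

End MixedDerivatives.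

(** * Signs of the kinds and the seventeen coefficients *)

Section KindSigns.

(* The derivative of kind [p] contracts an upper index with S + e T and a lower
   one with S + f T, where S and T are the symmetric and the skew part of the
   connection, e = [up_sign p] and f = [low_sign p]. *)
Definition up_sign (p : kind) : int := if p is K2 then -1 else 1.
Definition low_sign (p : kind) : int := if p is K1 then 1 else -1.

(** The values are read off from [ricci_matrix]; the halves compensate the factors 2 of the
    identity. Integer values make them independent of field and manifold. *)
Definition ricci_coef (p q r s : kind) (l : nat) : int :=
  let e := up_sign in let f := low_sign in
  let half (z : int) := (z %/ 2)%Z in
  match l with
  | 1 => half (f s - f p)
  | 2 => half (f r - f q)
  | 3 => half (- (f q + f s))
  | 4 => half (e q - e r)
  | 5 => half (e p - e s)
  | 6 => e p
  | 7 => - e r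
  | 8 => e p * e q
  | 9 => - (e r * e s)
  | 10 => half (- (e p * f q + e r * f s))
  | 11 => f p
  | 12 => - f r
  | 13 => f r * f s
  | 14 => - (f p * f q)
  | 15 => half (- (f p * f q + f r * f s))
  | 16 => half (e p * f q - e s * f r)
  | 17 => half (e q * f p - e r * f s)
  | _ => 0
  end.

Lemma ricci_coef_range p q r s l : ricci_coef p q r s l \in [:: 0; 1; -1].
Proof. by do 18?[case: l => [|l]]; case: p; case: q; case: r; case: s. Qed.

(** Every halved number is a sum or difference of two signs, hence even, so the integer division is
    exact. *)
Lemma double_ricci_coef p q r s : let e := up_sign in let f := low_sign in
  let c := ricci_coef p q r s in
  [/\ 2 * c 1%N = f s - f p, 2 * c 2%N = f r - f q,
      2 * c 3%N = - (f q + f s), 2 * c 4%N = e q - e r & 2 * c 5%N = e p - e s]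
  /\ [/\ 2 * c 10%N = - (e p * f q + e r * f s),
      2 * c 15%N = - (f p * f q + f r * f s),
      2 * c 16%N = e p * f q - e s * f r & 2 * c 17%N = e q * f p - e r * f s].
Proof. by case: p; case: q; case: r; case: s. Qed.

End KindSigns.

(** * The identity in the ring of matrices *)

Section MatrixIdentity.
Variables (R : comPzRingType) (N : nat).
Variables (ddA A dAm dAn Sm Sn Tm Tn dSmn dSnm dTmn dTnm : 'M[R]_N).
(* The contractions over k of T^k_mn and S^k_mn with a_|k ([TA], [SA]) and with
   T_k ([TT], [ST]). *)
Variables (TA SA TT ST : 'M[R]_N).

Let Am := dAm + Sm *m A - A *m Sm.
Let An := dAn + Sn *m A - A *m Sn.
Let Bm (e f : R) := Am + e *: (Tm *m A) - f *: (A *m Tm).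
Let Bn (e f : R) := An + e *: (Tn *m A) - f *: (A *m Tn).
Let Rc := dSmn - dSnm + Sn *m Sm - Sm *m Sn.
Let Tmn := dTmn + Sn *m Tm - Tm *m Sn - ST.
Let Tnm := dTnm + Sm *m Tn - Tn *m Sm - ST.

(** Both orders of differentiation share [ddA], [SA] and [ST], since second partials commute and
    S^k_mn is symmetric in m, n; T^k_mn changes sign, hence [+ fq] against [- fs]. *)
Lemma ricci_matrix (ep fp eq fq er fr es fs : R) :
  (ddA + ((dSmn + ep *: dTmn) *m A + (Sm + ep *: Tm) *m dAn)
       - (dAn *m (Sm + fp *: Tm) + A *m (dSmn + fp *: dTmn))
   + (Sn + eq *: Tn) *m Bm ep fp - Bm ep fp *m (Sn + fq *: Tn)
   - ((SA + ep *: (ST *m A) - fp *: (A *m ST))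
      + fq *: (TA + ep *: (TT *m A) - fp *: (A *m TT))))
  - (ddA + ((dSnm + er *: dTnm) *m A + (Sn + er *: Tn) *m dAm)
       - (dAm *m (Sn + fr *: Tn) + A *m (dSnm + fr *: dTnm))
   + (Sm + es *: Tm) *m Bn er fr - Bn er fr *m (Sm + fs *: Tm)
   - ((SA + er *: (ST *m A) - fr *: (A *m ST))
      - fs *: (TA + er *: (TT *m A) - fr *: (A *m TT))))
  = (fs - fp) *: (An *m Tm) + (fr - fq) *: (Am *m Tn) + (- (fq + fs)) *: TA
  + (eq - er) *: (Tn *m Am) + (ep - es) *: (Tm *m An)
  + (Rc + ep *: Tmn + (- er) *: Tnm + (ep * eq) *: (Tn *m Tm)
     + (- (er * es)) *: (Tm *m Tn) + (- (ep * fq + er * fs)) *: TT) *m A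
  - A *m (Rc + fp *: Tmn + (- fr) *: Tnm + (fr * fs) *: (Tn *m Tm)
     + (- (fp * fq)) *: (Tm *m Tn) + (- (fp * fq + fr * fs)) *: TT)
  - ((ep * fq - es * fr) *: (Tm *m A *m Tn)
     + (eq * fp - er * fs) *: (Tn *m A *m Tm)).
Proof.
(* Unlike [mxE], these keep matrix products folded, so that [ring] sees the entry of each monomial
   as an atom. *)
have entryD (X Y : 'M[R]_N) i j : (X + Y) i j = X i j + Y i j by rewrite mxE.
have entryN (X : 'M[R]_N) i j : (- X) i j = - X i j by rewrite mxE.
have entryZ a (X : 'M[R]_N) i j : (a *: X) i j = a * X i j by rewrite mxE.
apply/matrixP => i j; rewrite /Bm /Bn /Am /An /Rc /Tmn /Tnm.
rewrite !(mulmxDl, mulmxDr, mulNmx, mulmxN, =^~ scalemxAl, =^~ scalemxAr,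
          mulmxA, entryD, entryN, entryZ).
ring.
Qed.

End MatrixIdentity.

(** * Schwarz's theorem for smooth functions on an open set *)

Section SmoothPartials.
Variables (R : realType) (N : nat) (U : set 'rV[R]_N).
Hypothesis openU : open U.
Implicit Types (f : 'rV[R]_N -> R) (x : 'rV[R]_N).

Lemma smooth_partial f k : smooth_on U f -> smooth_on U (partial k f).
Proof. by move=> sf n; have [_ _] := sf n.+1; apply. Qed.

Lemma smooth_derivable f k x :
  smooth_on U f -> U x -> derivable f x (delta_mx 0 k).
Proof. by move=> sf; have [_ df _] := sf 1%N; exact: df. Qed.

Lemma smooth_partialC f k l x : smooth_on U f -> U x ->
  partial k (partial l f) x = partial l (partial k f) x.
Proof.
move=> sf Ux; have nearU : nbhs x U by exact: open_nbhs_nbhs.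
have sp k' := smooth_partial k' sf.
apply: derive_comm.
- apply: filterS nearU => y Uy.
  by split; [exact: smooth_derivable | exact: smooth_derivable (sp l) Uy].
- apply: filterS nearU => y Uy.
  by split; [exact: smooth_derivable | exact: smooth_derivable (sp k) Uy].
- exact: (smooth_partial k (sp l) 0%N) Ux.
- exact: (smooth_partial l (sp k) 0%N) Ux.
Qed.

End SmoothPartials.

(** * Splitting into S and T, and partial derivatives of a covariant derivative *)

Section Pointwise.
Variables (R : realType) (N : nat).
Variables (L : 'I_N -> 'I_N -> 'I_N -> 'rV[R]_N -> R).
Variables (a : 'I_N -> 'I_N -> 'rV[R]_N -> R).
Implicit Types (p : kind) (y : 'rV[R]_N).

Let S := symm_part L.
Let T := skew_part L.
Let e p : R := (up_sign p)%:~R.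
Let f p : R := (low_sign p)%:~R.

Lemma up_coefE p i j k y : up_coef p L i j k y = S i j k y + e p * T i j k y.
Proof. by rewrite /S /T /e /symm_part /skew_part; case: p => /=; field. Qed.

Lemma low_coefE p i j k y : low_coef p L i j k y = S i j k y + f p * T i j k y.
Proof. by rewrite /S /T /f /symm_part /skew_part; case: p => /=; field. Qed.

Lemma symm_partC i j k y : S i j k y = S i k j y.
Proof. by rewrite /S /symm_part addrC. Qed.

Lemma skew_partC i j k y : T i j k y = - T i k j y.
Proof. by rewrite /T /skew_part -mulrN opprB. Qed.

Lemma partial_cov11 p i j m n x :
  (forall i j k, derivable (L i j k) x (delta_mx 0 n)) ->
  (forall i j, derivable (a i j) x (delta_mx 0 n)) ->
  derivable (partial m (a i j)) x (delta_mx 0 n) ->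
  partial n (cov11 p L a i j m) x =
    partial n (partial m (a i j)) x
    + \sum_(al < N)
        ((partial n (S i al m) x + e p * partial n (T i al m) x) * a al j x
         + (S i al m x + e p * T i al m x) * partial n (a al j) x)
    - \sum_(al < N)
        ((partial n (S al j m) x + f p * partial n (T al j m) x) * a i al x
         + (S al j m x + f p * T al j m x) * partial n (a i al) x).
Proof.
move=> dL da dpa.
have dS i' j' k' : derivable (S i' j' k') x (delta_mx 0 n).
  by apply: derivableZ; apply: derivableD.
have dT i' j' k' : derivable (T i' j' k') x (delta_mx 0 n).
  by apply: derivableZ; apply: derivableB.
(* Rewritten in the algebra of functions, the expression can be differentiated by the sum and
   product rules. *)
have -> : cov11 p L a i j m = partial m (a i j)
    + \sum_(al < N) (S i al m + e p *: T i al m) * a al j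
    - \sum_(al < N) (S al j m + f p *: T al j m) * a i al.
  apply/funext => y; rewrite !fctE !fct_sumE /cov11; congr (_ + _ - _).
    by apply: eq_bigr => al _; rewrite !fctE up_coefE.
  by apply: eq_bigr => al _; rewrite !fctE low_coefE.
have dterm (F G H : 'rV[R]_N -> R) c :
    derivable F x (delta_mx 0 n) -> derivable G x (delta_mx 0 n) ->
    derivable H x (delta_mx 0 n) ->
    is_derive x (delta_mx 0 n) ((F + c *: G) * H)
      ((partial n F x + c * partial n G x) * H x
       + (F x + c * G x) * partial n H x).
  move=> /derivableP dF /derivableP dG /derivableP dH.
  by apply: is_derive_eq; rewrite addrC mulrC /GRing.scale /=; congr (_ + _).
have dtermU al := dterm _ _ _ (e p) (dS i al m) (dT i al m) (da al j).
have dtermL al := dterm _ _ _ (f p) (dS al j m) (dT al j m) (da i al).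
have /derivableP dpa' := dpa.
(* The derivative is assembled by inference from the [is_derive] facts in the context. *)
exact: derive_val.
Qed.

End Pointwise.

(** * The Ricci-type identity at a point *)

Section RicciIdentity.
Variables (R : realType) (N : nat).
Variables (L : 'I_N -> 'I_N -> 'I_N -> 'rV[R]_N -> R).
Variables (a : 'I_N -> 'I_N -> 'rV[R]_N -> R) (x : 'rV[R]_N).
Hypothesis dL : forall i j k l, derivable (L i j k) x (delta_mx 0 l).
Hypothesis da : forall i j l, derivable (a i j) x (delta_mx 0 l).
Hypothesis dpa :
  forall i j k l, derivable (partial k (a i j)) x (delta_mx 0 l).
Hypothesis paC :
  forall i j k l,
    partial k (partial l (a i j)) x = partial l (partial k (a i j)) x.
Implicit Types (p q r s : kind) (i j k l m n : 'I_N).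

Let S := symm_part L.
Let T := skew_part L.
Let e p : R := (up_sign p)%:~R.
Let f p : R := (low_sign p)%:~R.

(* The upper index of a component array is the row and the first lower index the
   column, so that contractions become matrix products and the remaining lower
   indices become parameters. *)
Let A := \matrix_(i, j) a i j x.
Let dA k := \matrix_(i, j) partial k (a i j) x.
Let ddA k l := \matrix_(i, j) partial l (partial k (a i j)) x.
Let Sm k := \matrix_(i, j) S i j k x.
Let Tm k := \matrix_(i, j) T i j k x.
Let dS k l := \matrix_(i, j) partial l (S i j k) x.
Let dT k l := \matrix_(i, j) partial l (T i j k) x.
Let Ad k := dA k + Sm k *m A - A *m Sm k.
(** Here [c] will be k -> S^k_mn or k -> T^k_mn, written [S^~ m ^~ n ^~ x] and [T^~ m ^~ n ^~ x]. *)
Let cA (c : 'I_N -> R) := \sum_k c k *: Ad k.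
Let cT (c : 'I_N -> R) := \sum_k c k *: Tm k.
Let Rc m n := dS m n - dS n m + Sm n *m Sm m - Sm m *m Sm n.
Let Td m n := dT m n + Sm n *m Tm m - Tm m *m Sm n - cT (S^~ m ^~ n ^~ x).

Lemma scov11_mx i j k : scov11 L a i j k x = Ad k i j.
Proof.
by rewrite /scov11 /cov11 !mxE /=; congr (_ + _ - _); apply: eq_bigr => al _;
  rewrite !mxE // mulrC.
Qed.

Lemma scov12_mx i j m n : scov12 L T i j m n x = Td m n i j.
Proof.
rewrite /scov12 /cov12 !mxE summxE /=.
congr (_ + _ - _ - _); apply: eq_bigr => al _; rewrite !mxE //.
by rewrite mulrC.
Qed.

Lemma curvature_mx i j m n : curvature L i j m n x = Rc m n i j.
Proof.
rewrite /curvature !mxE /=.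
by congr (_ + _ - _); apply: eq_bigr => al _; rewrite !mxE // mulrC.
Qed.

Let B p k := Ad k + e p *: (Tm k *m A) - f p *: (A *m Tm k).

Lemma cov11_mx p i j k : cov11 p L a i j k x = B p k i j.
Proof.
have -> : B p k = dA k + (Sm k + e p *: Tm k) *m A - A *m (Sm k + f p *: Tm k).
  rewrite /B /Ad mulmxDl mulmxDr -scalemxAl -scalemxAr opprD !addrA.
  by rewrite [_ - A *m _ + _]addrAC.
rewrite /cov11 !mxE; congr (_ + _ - _); apply: eq_bigr => al _.
  by rewrite !mxE up_coefE.
by rewrite !mxE low_coefE mulrC.
Qed.

Let cB p (c : 'I_N -> R) :=
  cA c + e p *: (cT c *m A) - f p *: (A *m cT c).

Lemma sum_B p (c : 'I_N -> R) : \sum_k c k *: B p k = cB p c.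
Proof.
rewrite /cB /cA /cT mulmx_suml mulmx_sumr !scaler_sumr -sumrN -!big_split.
apply: eq_bigr => k _; rewrite scalerBr scalerDr -scalemxAl -scalemxAr.
by rewrite !scalerA ![c k * _]mulrC.
Qed.

(** The corrections for [i] and [j] are left and right products; [m] is a parameter, so its
    correction is a linear combination of the matrices [B p k]. *)
Lemma cov12_mx p q i j m n :
  cov12 q L (cov11 p L a) i j m n x =
  (ddA m n + ((dS m n + e p *: dT m n) *m A + (Sm m + e p *: Tm m) *m dA n)
     - (dA n *m (Sm m + f p *: Tm m) + A *m (dS m n + f p *: dT m n))
   + (Sm n + e q *: Tm n) *m B p m - B p m *m (Sm n + f q *: Tm n)
   - (cB p (S^~ m ^~ n ^~ x) + f q *: cB p (T^~ m ^~ n ^~ x))) i j.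
Proof.
rewrite -!sum_B scaler_sumr -big_split /= /cov12 partial_cov11 //.
rewrite !(mxE, summxE) -!big_split /=.
congr (_ + _ - _ + _ - _ - _); apply: eq_bigr => al _.
- by rewrite !mxE.
- by rewrite !mxE addrC; congr (_ + _); rewrite mulrC.
- by rewrite up_coefE cov11_mx !mxE.
- by rewrite low_coefE cov11_mx !mxE mulrC.
- by rewrite low_coefE cov11_mx !mxE mulrDl mulrA.
Qed.

Lemma mulmx_mulmx_entry (X Y Z : 'M[R]_N) i j :
  (X *m Y *m Z) i j =
  \sum_(al < N) \sum_(be < N) Y al be * (X i al * Z be j).
Proof.
rewrite mxE exchange_big; apply: eq_bigr => be _; rewrite mxE mulr_suml.
by apply: eq_bigr => al _; rewrite mulrAC mulrC.
Qed.

Lemma ricci_identity p q r s i j m n :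
  let C (l : nat) : R := (ricci_coef p q r s l)%:~R in
  let T i j k := T i j k x in
  let Td i j k l := scov12 L (skew_part L) i j k l x in
  let Ad i j k := scov11 L a i j k x in
  let Rc i j k l := curvature L i j k l x in
  cov12 q L (cov11 p L a) i j m n x - cov12 s L (cov11 r L a) i j n m x
  = 2 * C 1%N * (\sum_(al < N) T al j m * Ad i al n)
  + 2 * C 2%N * (\sum_(al < N) T al j n * Ad i al m)
  + 2 * C 3%N * (\sum_(al < N) T al m n * Ad i j al)
  + 2 * C 4%N * (\sum_(al < N) T i al n * Ad al j m)
  + 2 * C 5%N * (\sum_(al < N) T i al m * Ad al j n)
  + \sum_(al < N) a al j x *
      (Rc i al m n + C 6%N * Td i al m n + C 7%N * Td i al n m
       + C 8%N * (\sum_(be < N) T be al m * T i be n)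
       + C 9%N * (\sum_(be < N) T be al n * T i be m)
       + 2 * C 10%N * (\sum_(be < N) T i al be * T be m n))
  - \sum_(al < N) a i al x *
      (Rc al j m n + C 11%N * Td al j m n + C 12%N * Td al j n m
       + C 13%N * (\sum_(be < N) T al be n * T be j m)
       + C 14%N * (\sum_(be < N) T al be m * T be j n)
       + 2 * C 15%N * (\sum_(be < N) T al j be * T be m n))
  - 2 * (\sum_(al < N) \sum_(be < N) a al be x *
      (C 16%N * (T i al m * T be j n) + C 17%N * (T i al n * T be j m))).
Proof.
move=> C T' Td' Ad' Rc'.
(* Exchanging [m] and [n] fixes S^k_mn and the second partials and reverses T^k_mn, which gives the
   shape of [ricci_matrix]. *)
have SC : S^~ n ^~ m ^~ x = S^~ m ^~ n ^~ x.
  by apply/funext => al; exact: symm_partC.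
have ddC : ddA n m = ddA m n by apply: eq_mx => i' j'; exact: paC i' j' m n.
have cBN : cB r (T^~ n ^~ m ^~ x) = - cB r (T^~ m ^~ n ^~ x).
  rewrite -!sum_B -sumrN; apply: eq_bigr => al _.
  by rewrite -scaleNr; congr (_ *: _); exact: skew_partC.
have entryD (X Y : 'M[R]_N) k l : (X + Y) k l = X k l + Y k l by rewrite mxE.
have entryN (X : 'M[R]_N) k l : (- X) k l = - X k l by rewrite mxE.
have entryZ c (X : 'M[R]_N) k l : (c *: X) k l = c * X k l by rewrite mxE.
rewrite !cov12_mx SC ddC cBN scalerN -entryN -entryD.
rewrite (congr1 (fun X : 'M[R]_N => X i j)
  (ricci_matrix (ddA m n) A (dA m) (dA n) (Sm m) (Sm n) (Tm m) (Tm n)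
    (dS m n) (dS n m) (dT m n) (dT n m) (cA (T^~ m ^~ n ^~ x))
    (cA (S^~ m ^~ n ^~ x)) (cT (T^~ m ^~ n ^~ x)) (cT (S^~ m ^~ n ^~ x))
    (e p) (f p) (e q) (f q) (e r) (f r) (e s) (f s))).
(* [Td n m] contracts with S^k_nm, hence [-SC] once [Td m n] is folded. *)
rewrite -/(Ad m) -/(Ad n) -/(Rc m n) -/(Td m n) -SC -/(Td n m).
have [[c1 c2 c3 c4 c5] [c10 c15 c16 c17]] := double_ricci_coef p q r s.
have twoC (l : nat) z : 2 * ricci_coef p q r s l = z -> 2 * C l = z%:~R.
  by move=> <-; rewrite rmorphM.
rewrite (twoC _ _ c1) (twoC _ _ c2) (twoC _ _ c3) (twoC _ _ c4) (twoC _ _ c5).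
rewrite (twoC _ _ c10) (twoC _ _ c15).
(* For these two the factor 2 stands outside the double sum, so they stay abstract while [C] is
   unfolded. *)
move: (C 16%N) (C 17%N) (twoC _ _ c16) (twoC _ _ c17) => C16 C17 e16 e17.
rewrite /C /= !(rmorphB, rmorphD, rmorphN, rmorphM) /= -!/(e _) -!/(f _).
rewrite !(rmorphB, rmorphM) /= -!/(e _) -!/(f _) in e16 e17.
(* The statement writes the factors in one order in the terms with [a al j] and in the other in
   those with [a i al]. *)
have entryTT al be k l :
    (Tm k *m Tm l) al be = \sum_(ga < N) T' ga be l * T' al ga k.
  by rewrite mxE; apply: eq_bigr => ga _; rewrite !mxE mulrC.
have entryTT' al be k l :
    (Tm k *m Tm l) al be = \sum_(ga < N) T' al ga k * T' ga be l.
  by rewrite mxE; apply: eq_bigr => ga _; rewrite !mxE.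
have entryTA k l al be :
    (Tm k *m Ad l) al be = \sum_(ga < N) T' al ga k * Ad' ga be l.
  by rewrite mxE; apply: eq_bigr => ga _; rewrite -scov11_mx mxE.
have entryAT k l al be :
    (Ad l *m Tm k) al be = \sum_(ga < N) T' ga be k * Ad' al ga l.
  by rewrite mxE; apply: eq_bigr => ga _; rewrite -scov11_mx mxE mulrC.
have entry_cA : cA (T^~ m ^~ n ^~ x) i j = \sum_(al < N) T' al m n * Ad' i j al.
  by rewrite summxE; apply: eq_bigr => al _; rewrite mxE -scov11_mx.
have entry_cT al be :
    cT (T^~ m ^~ n ^~ x) al be = \sum_(ga < N) T' al be ga * T' ga m n.
  by rewrite summxE; apply: eq_bigr => ga _; rewrite !mxE mulrC.
rewrite !(entryD, entryN, entryZ) !entryTA !entryAT entry_cA.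
congr (_ + _ + _ + _ + _ + _ - _ - _).
- rewrite mxE; apply: eq_bigr => al _; rewrite mulrC [A _ _]mxE.
  by rewrite 5!entryD 5!entryZ !entryTT entry_cT -curvature_mx -!scov12_mx.
- rewrite mxE; apply: eq_bigr => al _; rewrite [A _ _]mxE.
  by rewrite 5!entryD 5!entryZ !entryTT' entry_cT -curvature_mx -!scov12_mx.
rewrite !mulmx_mulmx_entry -e16 -e17 -!mulrA -mulrDr; congr (2 * _).
rewrite !mulr_sumr -big_split; apply: eq_bigr => al _.
rewrite !mulr_sumr -big_split; apply: eq_bigr => be _.
by rewrite !mxE /= mulrDr; congr (_ + _); rewrite mulrCA.
Qed.

End RicciIdentity.

Theorem theorem2p2 (p q r s : kind) :
  exists c : nat -> int,
    (forall l, (1 <= l <= 17)%N -> c l \in [:: 0; 1; -1]) /\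
    forall (R : realType) (N : nat) (M : manifold R N) (L : connection M)
           (a : tensor11 M) (u : chart M) (x : 'rV[R]_N), img u x ->
    forall i j m n : 'I_N,
    let C (l : nat) : R := (c l)%:~R in
    let A (i j : 'I_N) : R := a u i j x in
    let T (i j k : 'I_N) : R := skew_part (L u) i j k x in
    let Td (i j k l : 'I_N) : R := scov12 (L u) (skew_part (L u)) i j k l x in
    let Ad (i j k : 'I_N) : R := scov11 (L u) (a u) i j k x in
    let Rc (i j k l : 'I_N) : R := curvature (L u) i j k l x in
    cov12 q (L u) (cov11 p (L u) (a u)) i j m n x
    - cov12 s (L u) (cov11 r (L u) (a u)) i j n m x
    = 2 * C 1%N * (\sum_(al < N) T al j m * Ad i al n)
    + 2 * C 2%N * (\sum_(al < N) T al j n * Ad i al m)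
    + 2 * C 3%N * (\sum_(al < N) T al m n * Ad i j al)
    + 2 * C 4%N * (\sum_(al < N) T i al n * Ad al j m)
    + 2 * C 5%N * (\sum_(al < N) T i al m * Ad al j n)
    + \sum_(al < N) A al j *
        (Rc i al m n
         + C 6%N * Td i al m n
         + C 7%N * Td i al n m
         + C 8%N * (\sum_(be < N) T be al m * T i be n)
         + C 9%N * (\sum_(be < N) T be al n * T i be m)
         + 2 * C 10%N * (\sum_(be < N) T i al be * T be m n))
    - \sum_(al < N) A i al *
        (Rc al j m n
         + C 11%N * Td al j m n
         + C 12%N * Td al j n m
         + C 13%N * (\sum_(be < N) T al be n * T be j m)
         + C 14%N * (\sum_(be < N) T al be m * T be j n)
         + 2 * C 15%N * (\sum_(be < N) T al j be * T be m n))
    - 2 * (\sum_(al < N) \sum_(be < N) A al be *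
        (C 16%N * (T i al m * T be j n) + C 17%N * (T i al n * T be j m))).
Proof.
exists (ricci_coef p q r s); split=> [l _|]; first exact: ricci_coef_range.
move=> R N M L a u x ux i j m n C A T Td Ad Rc.
(* Smoothness on the open set [img u] supplies the pointwise hypotheses at [x]. *)
have sa i j : smooth_on (img u) (a u i j) := @tens_smooth _ _ _ a u i j.
have sp i j k := smooth_partial k (sa i j).
have dL i j k l : derivable (L u i j k) x (delta_mx 0 l) :=
  smooth_derivable (@conn_smooth _ _ _ L u i j k) ux.
have da i j l : derivable (a u i j) x (delta_mx 0 l) :=
  smooth_derivable (sa i j) ux.
have dpa i j k l : derivable (partial k (a u i j)) x (delta_mx 0 l) :=
  smooth_derivable (sp i j k) ux.
have paC i j k l := smooth_partialC (@img_open _ _ M u) k l (sa i j) ux.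
exact: (ricci_identity dL da dpa paC).
Qed.
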